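(* Let $I$ be a nonzero proper ideal of $R$. Then: (1) $a(I)=\displaystyle\sum_{h\notin V^I}(r_h-1)\;-\;l_R(I^{**}/I)\;-\;d(I)$; (2) $b(I)=\displaystyle\sum_{h\notin V^I}(r-r_h)\;+\;r\,l_R(I^{**}/I)\;+\;d(I)$. Here the sums run over all integers $h\ge 1$ with $h\notin V^I$ (a finite set).
   Context: Setting: $(R,\mathfrak m)$ is a one-dimensional Noetherian local domain with infinite residue field $k$ and fraction field $K$. Its integral closure $\overline R$ in $K$ is a finite $R$-module and a discrete valuation ring with uniformizer $t$ (analytically irreducible), and $R$ is residually rational: the natural map $k\to\overline R/t\overline R$ is an isomorphism. $v:K\to\mathbb Z\cup\{\infty\}$ is the valuation of $\overline R$ with $v(t)=1$; for a subset $J\subseteq K$, $v(J)=\{v(a): 0\ne a\in J\}$. $l_R$ denotes length of $R$-modules. For fractional ideals, $I:J=\{x\in K: xJ\subseteq I\}$, $I^*=R:I$, $I^{**}=(I^* )^*$. Put $\gamma=R:\overline R=t^c\overline R$ with $c=l_R(\overline R/\gamma)$, $\delta=l_R(\overline R/R)$, $n=c-\delta=l_R(R/\gamma)$, $r=l_R((R:\mathfrak m)/R)$. Type sequence: let $s_0=0<s_1<\dots<s_n=c<s_{n+1}=c+1<\dots$ be the elements of $v(R)$, $R_i=\{a\in R: v(a)\ge s_i\}$, and for $i\ge1$ let $r_i=l_R\big((R:R_i)/(R:R_{i-1})\big)$. One has $r_1=r$, and $r_i=1$ for $i>n$; the type sequence of $R$ is $[r_1,\dots,r_n]$. For a nonzero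 proper ideal $I$ of $R$: $\gamma_I=t^{c_I}\overline R$ is the largest $\overline R$-ideal contained in $I$; $n_I=l_R(R/\gamma_I)=c_I-\delta$; $V^I=\{h+1: h\ge0,\ s_h\in v(I^{**})\}$; $d(I)=l_R\big((R:\gamma_I)/I^*\big)-\sum_{h\le n_I,\,h\in V^I}r_h$; $a(I)=l_R(I^*/R)-l_R(R/I)$; $b(I)=r\,l_R(R/I)-l_R(I^*/R)$. *)

(* Defs.v *)
From HB Require Import structures.
From mathcomp Require Import all_boot all_order all_algebra.
From mathcomp Require Import all_classical constructive_ereal.

Set Implicit Arguments.
Unset Strict Implicit.
Unset Printing Implicit Defensive.

Import Order.TTheory GRing.Theory Num.Theory.
Local Open Scope classical_set_scope.
Local Open Scope ring_scope.

Section Modules.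
Variable T : comNzRingType.
Implicit Types (A S M N : set T).

(* [A] is meant to be a subring of [T]; the [A]-submodules of [T]. *)
Definition submodule A S : Prop :=
  [/\ S 0, forall x y, S x -> S y -> S (x + y)
    & forall a x, A a -> S x -> S (a * x)].

Definition span A (s : seq T) : set T :=
  [set x | exists2 c : nat -> T, (forall i, A (c i))
           & x = \sum_(i < size s) c i * s`_i].

Definition finitely_generated A S : Prop := exists s : seq T, S = span A s.

(* Strict chains M <= C 0 < C 1 < ... < C l <= N of A-submodules, i.e. strict
   chains with l steps of submodules of the A-module N / M. *)
Definition chain A N M (l : nat) (C : nat -> set T) : Prop :=
  (forall i, (i <= l)%N -> [/\ submodule A (C i), M `<=` C i & C i `<=` N]) /\
  (forall i, (i < l)%N -> C i `<` C i.+1).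

Definition is_length A N M (l : nat) : Prop :=
  (exists C, chain A N M l C) /\
  (forall l' C, chain A N M l' C -> (l' <= l)%N).

(* Length of the A-module N / M, for submodules M <= N; the default value 0 is
   taken when the length is infinite, which does not occur for quotients of
   fractional ideals of a one-dimensional Noetherian domain. *)
Definition length A N M : nat := xget 0%N [set l | is_length A N M l].

End Modules.

Section Rings.
Variable R : comNzRingType.

Definition noetherian : Prop :=
  forall J : set R, submodule setT J -> finitely_generated setT J.

(* Elements of [idealr R] and [prime_idealr R] are proper ideals. *)
Definition maximal_ideal (M : idealr R) : Prop :=
  forall J : idealr R, {subset M <= J} -> M =i J.

Definition local_ring (m : idealr R) : Prop :=
  maximal_ideal m /\ forall M : idealr R, maximal_ideal M -> M =i m.

Definition prime_chain (l : nat) (P : nat -> prime_idealr R) : Prop :=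
  forall i, (i < l)%N -> {subset P i <= P i.+1} /\ ~ (P i =i P i.+1).

Definition krull_dim (d : nat) : Prop :=
  (exists P, prime_chain d P) /\
  (forall l P, prime_chain l P -> (l <= d)%N).

End Rings.

Section Fields.
Variable K : fieldType.
Implicit Types (A I J : set K) (v : K -> \bar int).

Definition colon I J : set K := [set x | forall y, J y -> I (x * y)].

Definition valuation v : Prop :=
  [/\ forall x, v x = +oo%E <-> x = 0,
      forall x, v x <> -oo%E,
      forall x y, v (x * y) = (v x + v y)%E
    & forall x y, (mine (v x) (v y) <= v (x + y)%R)%E].

(* [A] is a discrete valuation ring of [K] with uniformizer [t] and normalized
   valuation [v]. *)
Definition dvr A v (t : K) : Prop :=
  [/\ valuation v, v t = 1%:E & A = [set x | (0 <= v x)%E]].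

(* As [h%:E] is finite, the zero element of [J] does not contribute. *)
Definition values v J : set int := [set h | exists2 a, J a & v a = h%:E].

(* When [I] is closed under addition and contains 0, this union is itself an
   [A]-submodule: with J and J', the sum J + J' is contained in [I]. *)
Definition largest_submodule A I : set K :=
  \bigcup_(J in [set J | submodule A J /\ J `<=` I]) J.

End Fields.

Section FractionField.
Variable R : idomainType.
Local Notation K := {fraction R}.
Local Notation RK := (range (@tofrac R)).
Implicit Types (I J : set K) (v : K -> \bar int) (s : nat -> int).

Definition ideal_in_frac (I : {pred R}) : set K := @tofrac R @` [set` I].

Definition integral_closure : set K := [set x | integralOver (@tofrac R) x].

Definition residually_rational (m : {pred R}) (t : K) : Prop :=
  let tRbar := [set t * y | y in integral_closure] in
  (* the natural map R/m -> Rbar/tRbar is well defined and injective *)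
  (forall a : R, a \in m <-> tRbar (tofrac a)) /\
  (* and surjective *)
  (forall x, integral_closure x -> exists a : R, tRbar (x - tofrac a)).

Definition lenR (N M : set K) : nat := length RK N M.

Definition dual J : set K := colon RK J.

(* [s] lists the elements of v(R) in increasing order. *)
Definition value_enum v s : Prop :=
  {homo s : i j / (i < j)%N >-> i < j} /\ range s = values v RK.

Definition filtration v s (i : nat) : set K :=
  [set a | RK a /\ ((s i)%:E <= v a)%E].

(* r_i for i >= 1; the value at i = 0 is irrelevant. *)
Definition type_seq v s (i : nat) : nat :=
  lenR (dual (filtration v s i)) (dual (filtration v s i.-1)).

Definition cm_type (m : {pred R}) : nat := lenR (dual (ideal_in_frac m)) RK.

Definition gamma I : set K := largest_submodule integral_closure I.

Definition n_ I : nat := lenR RK (gamma I).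

Definition V_ v s I : set nat :=
  [set h.+1 | h in [set h | values v (dual (dual I)) (s h)]].

Definition d_ v s I : int :=
  (lenR (dual (gamma I)) (dual I))%:Z
  - \sum_(1 <= h < (n_ I).+1 | h \in V_ v s I) (type_seq v s h)%:Z.

Definition a_ I : int := (lenR (dual I) RK)%:Z - (lenR RK I)%:Z.

Definition b_ (m : {pred R}) I : int :=
  (cm_type m)%:Z * (lenR RK I)%:Z - (lenR (dual I) RK)%:Z.

End FractionField.

(* Main.v *)
Require Import Defs.
From HB Require Import structures.
From mathcomp Require Import all_boot all_order all_algebra.
From mathcomp Require Import all_classical constructive_ereal.
From mathcomp Require Import zify ring.
Import Order.TTheory GRing.Theory Num.Theory.
Local Open Scope classical_set_scope.
Local Open Scope ring_scope.

(** The length of a quotient of two fractional ideals can be read off from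
    their value sets.  Write ge h for the set of elements of value at least h.
    If M is contained in N, and if every element of the valuation ring is
    congruent to an element of R modulo its maximal ideal, then an element of N
    whose value is attained in M can be corrected by an element of M so that
    its value increases; as M contains some ge a, N = M as soon as
    v(N) = v(M) (sub_values_eq).  Hence along a strict chain from M to N the
    value sets grow strictly, so that a chain has at most #(v(N) \ v(M)) steps.
    Conversely the submodules M + (N /\ ge h), with h running downwards through
    the missing values, form a chain of that length.  So
    l(N / M) = #(v(N) \ v(M)) (length_values), and length is additive (lengthD).

    Let now I be a nonzero ideal, I' = R : I its dual and I'' = R : I' its
    bidual.  The largest ideal of the valuation ring inside I is some ge c; as c
    is a value of R, it is the member R_n of the filtration of R by values, with
    n = l(R / R_n).  Three computations give the theorem, W being the set of the
    indices h outside V^I: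
    - I is contained in I'', hence l(R / I) = l(R / I'') + l(I'' / I), and
      l(R / I'') = #W because s_(h-1) is missing from v(I'') exactly when h is
      in W;
    - the chain of the R : R_h telescopes to l((R : R_n) / R) = r_1 + ... + r_n;
    - R is contained in I', and I' in R : R_n, hence
      l(I' / R) = r_1 + ... + r_n - l((R : R_n) / I'), which by the definition
      of d(I) is the sum of the r_h over W minus d(I).
    Since R_n is contained in I'', all h > n are in V^I; so W is a finite set of
    indices between 1 and n, and a(I) and b(I) follow by subtraction. *)

(** * Valuations *)

Section Valuation.
Local Set Implicit Arguments.
Local Unset Strict Implicit.
Variables (K : fieldType) (v : K -> \bar int).

Definition val_ge (h : int) : set K := [set x | (h%:E <= v x)%E].

Hypothesis vP : valuation v.

Lemma val_fin x : x != 0 -> exists h, v x = h%:E.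
Proof.
case: vP => v0 vN _ _ x0; case E : (v x) => [h| |]; first by exists h.
  by move/v0: E x0 => ->; rewrite eqxx.
by case: (vN _ E).
Qed.

Lemma val_neq0 x h : v x = h%:E -> x != 0.
Proof. by case: vP => v0 _ _ _ vx; apply/eqP => /v0; rewrite vx. Qed.

Lemma val1 : v 1 = 0%:E.
Proof.
case: (val_fin (oner_neq0 _)) => h vh; case: vP => _ _ vM _.
by have := vM 1 1; rewrite mulr1 vh -EFinD => -[] ?; congr EFin; lia.
Qed.

Lemma valN x : v (- x) = v x.
Proof.
case: vP => _ _ vM _.
have N1 : v (- 1) = 0%:E.
  have [h vh] : exists h, v (-1) = h%:E.
    by apply: val_fin; rewrite oppr_eq0 oner_neq0.
  have := vM (-1) (-1); rewrite mulrNN mulr1 val1 vh -EFinD => -[] ?.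
  by congr EFin; lia.
by rewrite -mulN1r vM N1 add0e.
Qed.

Lemma val_ge_sub g h : g <= h -> val_ge h `<=` val_ge g.
Proof. by move=> gh x; apply: le_trans; rewrite lee_fin. Qed.

Lemma val_ge0 h : val_ge h 0.
Proof. by case: vP => v0 _ _ _; rewrite /val_ge /= (v0 0).2 // leey. Qed.

Lemma val_geN h x : val_ge h x -> val_ge h (- x).
Proof. by rewrite /val_ge /= valN. Qed.

Lemma val_geD h x y : val_ge h x -> val_ge h y -> val_ge h (x + y).
Proof.
case: vP => _ _ _ vD; rewrite /val_ge /= => hx hy.
by apply: le_trans (vD x y); rewrite le_min hx.
Qed.

Lemma val_geM g h x y : val_ge g x -> val_ge h y -> val_ge (g + h) (x * y).
Proof. by case: vP => _ _ vM _ gx hy; rewrite /val_ge /= vM EFinD leeD. Qed.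

(** Lets exact values be handled through the additive subgroups val_ge alone. *)
Lemma val_eqP x h : v x = h%:E <-> val_ge h x /\ ~ val_ge (h + 1) x.
Proof.
rewrite /val_ge /=; case: vP => _ vN _ _.
case E : (v x) => [g| |]; rewrite ?leey ?lee_fin; last by case: (vN _ E).
  by split=> [[->]|[? ?]]; last (congr EFin; lia); split; lia.
by split=> // -[_ []].
Qed.

Lemma valV x h : v x = h%:E -> v x^-1 = (- h)%:E.
Proof.
case: vP => _ _ vM _ vx; have x0 := val_neq0 vx.
have [g vg] : exists g, v x^-1 = g%:E by apply: val_fin; rewrite invr_eq0.
have := vM x x^-1; rewrite divff // val1 vx vg -EFinD => -[] ?.
by congr EFin; lia.
Qed.

Lemma val_ge_div x y g h : val_ge g x -> v y = h%:E -> val_ge (g - h) (x / y).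
Proof. by move=> gx /valV vy; apply: val_geM gx _; rewrite /val_ge /= vy. Qed.

Lemma exists_val t h : v t = 1%:E -> exists x, v x = h%:E.
Proof.
move=> vt; have vX n : v (t ^+ n) = n%:Z%:E.
  case: vP => _ _ vM _; elim: n => [|n IHn]; first by rewrite expr0 val1.
  by rewrite exprS vM vt IHn -EFinD; congr EFin; lia.
case: h => n; first by exists (t ^+ n).
by exists (t ^+ n.+1)^-1; rewrite (valV (vX _)) NegzE.
Qed.

Lemma values_sub (M N : set K) : M `<=` N -> values v M `<=` values v N.
Proof. by move=> MN h [x Mx vx]; exists x => //; apply: MN. Qed.

End Valuation.

(** * Fractional ideals and their value sets *)

Section Lattice.
Local Set Implicit Arguments.
Local Unset Strict Implicit.
Variables (K : fieldType) (A : set K) (v : K -> \bar int) (t : K).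
Hypotheses (vP : valuation v) (vt : v t = 1%:E).
Hypotheses (A1 : A 1) (AN1 : A (-1)) (AM : forall a b, A a -> A b -> A (a * b))
  (AD : forall a b, A a -> A b -> A (a + b)).
Hypothesis A_ge0 : A `<=` val_ge v 0.
Hypothesis A_residue :
  forall x, val_ge v 0 x -> exists2 a, A a & val_ge v 1 (x - a).
Local Notation ge := (val_ge v).

(** The nonzero fractional ideals of A, when A itself contains some ge a.  The
    two bounds are what makes the value sets of nested lattices differ by a
    finite set. *)
Definition lattice (M : set K) : Prop :=
  [/\ submodule A M, exists a, ge a `<=` M & exists b, M `<=` ge b].

Lemma submoduleN M x : submodule A M -> M x -> M (- x).
Proof. by case=> _ _ MM Mx; rewrite -mulN1r; apply: MM. Qed.

Lemma submodule_ge h : submodule A (ge h).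
Proof.
split; [exact: val_ge0 | by move=> x y; apply: val_geD |].
by move=> a x /A_ge0 a0 hx; rewrite -[h]add0r; apply: val_geM.
Qed.

Lemma submoduleI M N : submodule A M -> submodule A N -> submodule A (M `&` N).
Proof.
move=> [M0 MD MM] [N0 ND NM]; split=> //.
- by move=> x y [? ?] [? ?]; split; [apply: MD|apply: ND].
- by move=> a x Aa [? ?]; split; [apply: MM|apply: NM].
Qed.

Definition sumset (M N : set K) : set K := [set x + y | x in M & y in N].

Lemma submodule_sum M N :
  submodule A M -> submodule A N -> submodule A (sumset M N).
Proof.
move=> [M0 MD MM] [N0 ND NM]; split.
- by exists 0 => //; exists 0 => //; rewrite addr0.
- move=> _ _ [x Mx [y Ny <-]] [x' Mx' [y' Ny' <-]].
  by exists (x + x'); [exact: MD|exists (y + y'); [exact: ND|rewrite addrACA]].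
- move=> a _ Aa [x Mx [y Ny <-]].
  by exists (a * x); [exact: MM|exists (a * y); [exact: NM|rewrite mulrDr]].
Qed.

(** For x in N, subtracting from x a suitable multiple b * y of an element y of
    M with the same value raises the value, by residual rationality; after
    finitely many corrections x falls into ge a, hence into M. *)
Lemma sub_values_eq M N a : submodule A M -> submodule A N -> M `<=` N ->
  ge a `<=` M -> values v N `<=` values v M -> N `<=` M.
Proof.
move=> sM sN MN aM vNM.
(* k bounds the number of corrections still needed *)
have step k x : N x -> ge (a - k%:Z) x -> M x.
  elim: k => [|k IHk] in x *; first by rewrite subr0 => _ /aM.
  move=> Nx gx; have [|ngx] := pselect (ge (a - k%:Z) x); first exact: IHk.
  have vx : v x = (a - k.+1%:Z)%:E.
    by apply/(val_eqP vP _ _); split; rewrite // (_ : _ + 1 = a - k%:Z) //; lia.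
  have [y My vy] : values v M (a - k.+1%:Z) by apply: vNM; exists x.
  have y0 := val_neq0 vP vy.
  have [|b Ab gb] := @A_residue (x / y).
    by rewrite -(subrr (a - k.+1%:Z)); apply: val_ge_div.
  have [_ ND _] := sN; have [_ MD MM] := sM.
  have Mby : M (b * y) by apply: MM.
  rewrite -(subrK (b * y) x); apply: (MD) => //; apply: IHk.
    by apply: ND => //; apply: submoduleN => //; apply: MN.
  rewrite (_ : x - b * y = (x / y - b) * y); last by rewrite mulrBl divfK.
  rewrite (_ : a - k%:Z = 1 + (a - k.+1%:Z)); last by lia.
  by apply: val_geM => //; rewrite /val_ge /= vy.
move=> x Nx; have [->|x0] := eqVneq x 0; first by case: sM.
have [h vx] := val_fin vP x0.
by apply: (step `|a - h|%N) => //; rewrite /val_ge /= vx lee_fin; lia.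
Qed.

Lemma values_diff_finite M N : lattice M -> lattice N ->
  finite_set (values v N `\` values v M).
Proof.
move=> [_ [a aM] _] [_ _ [b Nb]].
apply: (@sub_finite_set _ _ ((fun k : nat => b + k%:Z) @` `I_`|a - b|%N.+1)).
  move=> h [[x Nx vx]] nM.
  have := Nb _ Nx; rewrite /val_ge /= vx lee_fin => bh.
  have ha : h < a.
    rewrite ltNge; apply/negP => ah; apply: nM.
    by exists x => //; apply: aM; rewrite /val_ge /= vx lee_fin.
  by exists `|h - b|%N; [rewrite /=; lia | lia].
by apply: finite_image.
Qed.

(** Each step of a strict chain creates a new value, by sub_values_eq. *)
Lemma chain_uniq_values N M l C a : chain A N M l C -> ge a `<=` M ->
  exists ds : seq int, [/\ uniq ds, size ds = l &
    [set` ds] `<=` values v N `\` values v M].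
Proof.
move=> [CP Clt] aM.
have step i : (i <= l)%N -> exists ds : seq int, [/\ uniq ds, size ds = i &
    [set` ds] `<=` values v (C i) `\` values v M].
  elim: i => [|i IHi] il; first by exists [::]; split.
  have [ds [uds sds dsC]] := IHi (ltnW il).
  have [sC MC CN] := CP i (ltnW il); have [sC' _ _] := CP i.+1 il.
  have [CC nCC] := Clt i il.
  have [h [hC' hC]] : exists h, values v (C i.+1) h /\ ~ values v (C i) h.
    apply: contrapT => /forallNP nh; apply: nCC.
    apply: (sub_values_eq (a := a)) => // [|h hC'].
      exact: subset_trans MC.
    by apply: contrapT => hC; apply: (nh h).
  exists (h :: ds); split=> /=; [|by rewrite sds|].
    by rewrite uds andbT; apply/negP => /dsC [].
  move=> k; rewrite /= inE => /orP[/eqP ->|/dsC [kC kM]]; split=> //.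
    by move/(values_sub MC).
  by apply: values_sub kC.
have [ds [uds sds dsC]] := step l (leqnn l); have [_ _ CN] := CP l (leqnn l).
by exists ds; split=> // h /dsC [hC hM]; split=> //; apply: values_sub hC.
Qed.

(** Adjoining to M the parts of N of value at least h, for smaller and smaller
    missing values h, is strict at each step: an element x of N of missing value
    h cannot be y + z with y in M and v(z) > h, since y would have value h. *)
Lemma exists_chain N M a (ds : seq int) : submodule A N -> submodule A M ->
  M `<=` N -> ge a `<=` M -> uniq ds ->
  [set` ds] `<=` values v N `\` values v M ->
  exists C, chain A N M (size ds) C.
Proof.
move=> sN sM MN aM uds dsE.
pose es := sort <=%R ds.
have es_lt : sorted <%R es by rewrite sort_lt_sorted.
have esE : es =i ds by move=> h; rewrite mem_sort.
have ses : size es = size ds by rewrite size_sort.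
have lt_es j : (j < size es)%N -> nth a es j < nth a es j.+1.
  move=> jes; have [j1|j1] := ltnP j.+1 (size es).
    by apply: (sorted_ltn_nth lt_trans) => //; rewrite ?inE.
  rewrite [ltRHS]nth_default // ltNge; apply/negP => aj.
  have [[x Nx vx]] : (values v N `\` values v M) (nth a es j).
    by apply: dsE; rewrite /= -esE mem_nth.
  by apply; exists x => //; apply: aM; rewrite /val_ge /= vx lee_fin.
(* the i-th threshold is the i-th largest entry of es; for i = 0 the index is out
   of range and the default value a gives M itself *)
exists (fun i => sumset M (N `&` ge (nth a es (size ds - i)))); split=> i il.
  split.
  - by apply: submodule_sum => //; apply: submoduleI => //; apply: submodule_ge.
  - move=> x Mx; exists x => //; exists 0; rewrite ?addr0 //; split.
      by case: sN.
    exact: val_ge0.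
  - move=> _ [x Mx [y [Ny _] <-]]; case: sN => _ ND _.
    by apply: ND => //; apply: MN.
set j := (size ds - i.+1)%N; have -> : (size ds - i = j.+1)%N by rewrite /j; lia.
have jes : (j < size es)%N by rewrite ses /j; lia.
split=> [_ [x Mx [y [Ny gy] <-]]|sub].
  exists x => //; exists y => //; split=> //.
  by apply: val_ge_sub gy; apply/ltW/lt_es.
have [[x Nx vx] nM] : (values v N `\` values v M) (nth a es j).
  by apply: dsE; rewrite /= -esE mem_nth.
have [gx ngx] := (val_eqP vP _ _).1 vx.
have [|y My [z [Nz gz] xE]] := sub x.
  by exists 0; [case: sM|exists x; rewrite ?add0r].
have gz' : ge (nth a es j + 1) z.
  by apply: val_ge_sub gz; have := lt_es j jes; lia.
apply: nM; exists y => //; apply/(val_eqP vP _ _).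
have yE : y = x - z by rewrite -xE addrK.
split.
  rewrite yE; apply: val_geD => //; apply: val_geN => //.
  by apply: val_ge_sub gz'; lia.
by move=> gy; apply: ngx; rewrite -xE; apply: val_geD.
Qed.

Lemma is_length_values N M (ds : seq int) : lattice N -> lattice M ->
  M `<=` N -> uniq ds -> values v N `\` values v M = [set` ds] ->
  is_length A N M (size ds).
Proof.
move=> [sN _ _] [sM [a aM] _] MN uds dsE; split.
  by apply: (exists_chain (a := a)) => //; rewrite dsE.
move=> l C /chain_uniq_values /(_ aM) [es [ues <- esE]].
by apply: uniq_leq_size => // h /esE; rewrite dsE.
Qed.

Lemma length_values N M (ds : seq int) : lattice N -> lattice M ->
  M `<=` N -> uniq ds -> values v N `\` values v M = [set` ds] ->
  length A N M = size ds.
Proof.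
move=> lN lM MN uds dsE; have [Cds maxds] := is_length_values lN lM MN uds dsE.
apply: xget_unique; first by split.
move=> l [[C Cl] maxl]; apply/eqP; rewrite eqn_leq (maxds _ _ Cl) /=.
by case: Cds => D /maxl.
Qed.

Lemma exists_values_seq N M : lattice N -> lattice M ->
  exists2 ds : seq int, uniq ds & values v N `\` values v M = [set` ds].
Proof.
move=> lN lM; have /finite_seqP[ds dsE] := values_diff_finite lM lN.
exists (undup ds); rewrite ?undup_uniq // dsE.
by apply/seteqP; split=> h /=; rewrite mem_undup.
Qed.

Lemma lengthD N M L : lattice N -> lattice M -> lattice L ->
  L `<=` M -> M `<=` N -> length A N L = (length A N M + length A M L)%N.
Proof.
move=> lN lM lL LM MN.
have [ds uds dsE] := exists_values_seq lN lM.
have [es ues esE] := exists_values_seq lM lL.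
rewrite (length_values (N := N) (M := M) (ds := ds)) //.
rewrite (length_values (N := M) (M := L) (ds := es)) // -size_cat.
apply: length_values => //; first exact: subset_trans MN.
  rewrite cat_uniq uds ues andbT /=; apply/hasPn => h hes; apply/negP => hds.
  have [hM _] : (values v M `\` values v L) h by rewrite esE.
  by have [_] : (values v N `\` values v M) h by rewrite dsE.
have -> : [set` ds ++ es] = [set` ds] `|` [set` es].
  by apply/seteqP; split=> h /=; rewrite mem_cat => /orP.
rewrite -dsE -esE; apply/seteqP; split=> h.
  by move=> [hN hL]; have [hM|hM] := pselect (values v M h); [right|left].
move=> [[hN hM]|[hM hL]]; split=> //; last exact: values_sub hM.
by move/(values_sub LM).
Qed.

Lemma submodule_colon I J : submodule A I -> submodule A (colon I J).
Proof.
move=> [I0 ID IM]; split.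
- by move=> y _; rewrite mul0r.
- by move=> x y Ix Iy z Jz; rewrite mulrDl; apply: ID; [apply: Ix|apply: Iy].
- by move=> a x Aa Ix z Jz; rewrite -mulrA; apply: IM => //; apply: Ix.
Qed.

Lemma lattice_colon I J : lattice I -> lattice J -> lattice (colon I J).
Proof.
move=> [sI [a aI] [b Ib]] [sJ [c cJ] [d Jd]]; split; first exact: submodule_colon.
  exists (a - d) => x gx y /Jd gy; apply: aI.
  by rewrite -(subrK d a); apply: val_geM.
have [u vu] := exists_val vP c vt; exists (b - c) => x cx.
have u0 := val_neq0 vP vu.
rewrite -(mulfK u0 x); apply: val_ge_div => //; apply/Ib/cx/cJ.
by rewrite /val_ge /= vu.
Qed.

Hypothesis A_lattice : exists a, ge a `<=` A.

Lemma submoduleA : submodule A A.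
Proof. by split=> //; rewrite -(subrr 1); apply: AD. Qed.

Lemma latticeA : lattice A.
Proof. by split=> //; [exact: submoduleA|exists 0]. Qed.

Lemma latticeI_val_ge h M : lattice M -> lattice (M `&` ge h).
Proof.
move=> [sM [a aM] [b Mb]]; split.
- by apply: submoduleI => //; apply: submodule_ge.
- exists (Num.max a h) => x gx; split.
    by apply: aM; apply: val_ge_sub gx; lia.
  by apply: val_ge_sub gx; lia.
- by exists b => x [/Mb].
Qed.

Lemma colonAA : colon A A = A.
Proof.
apply/seteqP; split=> [x /(_ _ A1)|x Ax y Ay]; first by rewrite mulr1.
exact: AM.
Qed.

Lemma lengthMM M : lattice M -> length A M M = 0%N.
Proof.
move=> lM; apply: (length_values (ds := [::])); rewrite // setDv.
by apply/seteqP; split.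
Qed.

(** A submodule over the valuation ring contains ge (v x) with each of its
    nonzero elements x; so the union of those inside M is ge c for the least c
    such that ge c is inside M. *)
Lemma largest_submodule_val_ge M : lattice M ->
  exists c, largest_submodule (ge 0) M = ge c.
Proof.
move=> [_ [a aM] [b Mb]].
have bd c : ge c `<=` M -> b <= c.
  move=> cM; have [x vx] := exists_val vP c vt.
  have /cM /Mb : ge c x by rewrite /val_ge /= vx.
  by rewrite /val_ge /= vx lee_fin.
have [k /asboolP kM kmin] : {k : nat | `[< ge (b + k%:Z) `<=` M >] &
    forall j : nat, ge (b + j%:Z) `<=` M -> (k <= j)%N}.
  have ex : exists k : nat, `[< ge (b + k%:Z) `<=` M >].
    exists `|a - b|%N; apply/asboolP => x gx; apply: (aM).
    by apply: val_ge_sub gx; have := bd _ aM; lia.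
  by case: (ex_minnP ex) => k kP kmin; exists k => // j /asboolP /kmin.
exists (b + k%:Z); apply/seteqP; split=> [x [J [[J0 _ JM] JI] Jx]|].
  have [->|x0] := eqVneq x 0; first exact: val_ge0.
  have [h vx] := val_fin vP x0.
  have hM : ge h `<=` M.
    move=> y gy; apply: JI; rewrite -(divfK x0 y); apply: JM => //.
    by rewrite -(subrr h); apply: val_ge_div.
  rewrite /val_ge /= vx lee_fin; have := bd _ hM => bh.
  have hE : b + `|h - b|%N%:Z = h by lia.
  by have := kmin `|h - b|%N; rewrite hE => /(_ hM); lia.
move=> x gx; exists (ge (b + k%:Z)) => //; split=> //.
split; [exact: val_ge0 | by move=> y z; apply: val_geD |].
by move=> y z y0 gz; rewrite -[b + _]add0r; apply: val_geM.
Qed.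

(** * The filtration by values and the type sequence *)

Variable s : nat -> int.
Hypotheses (s_homo : {homo s : i j / (i < j)%N >-> i < j})
  (s_range : range s = values v A).
Local Notation F i := (A `&` ge (s i)).

Lemma lattice_filtration i : lattice (F i).
Proof. exact/latticeI_val_ge/latticeA. Qed.

Lemma leq_s : {mono s : i j / (i <= j)%N >-> i <= j}.
Proof.
move=> i j; have [ij|ji] := leqP i j; last by rewrite lt_geF ?s_homo.
move: ij; rewrite leq_eqVlt => /orP[/eqP ->|/s_homo /ltW ->//].
by rewrite lexx.
Qed.

Lemma s_inj : injective s.
Proof.
by move=> i j sij; apply/eqP; rewrite eqn_leq -!leq_s sij lexx.
Qed.

Lemma filtration0 : F 0%N = A.
Proof.
apply/seteqP; split=> [x []//|x Ax]; split=> //.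
have [->|x0] := eqVneq x 0; first exact: val_ge0.
have [h vx] := val_fin vP x0.
have [j _ sj] : range s h by rewrite s_range; exists x.
by rewrite /val_ge /= vx lee_fin -sj leq_s.
Qed.

Lemma values_filtration n j : values v (F n) (s j) <-> (n <= j)%N.
Proof.
rewrite -leq_s; split=> [[x [_]]|nj].
  by rewrite /val_ge /= => + vx; rewrite vx lee_fin.
have [x Ax vx] : values v A (s j) by rewrite -s_range; exists j.
by exists x => //; split=> //; rewrite /val_ge /= vx lee_fin.
Qed.

(** The value s_j is recorded by the index h = j + 1, the shift that is built
    into the sets V^I; the hypothesis on n confines the missing values to
    s_0, ..., s_(n-1). *)
Lemma length_index_missing M n : lattice M -> M `<=` A -> F n `<=` M ->
  length A A M =
  size [seq h <- index_iota 1 n.+1 | `[< ~ values v M (s h.-1) >]].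
Proof.
move=> lM MA FM.
have -> : index_iota 1 n.+1 = map succn (iota 0 n).
  by rewrite /index_iota subSS subn0 -[1%N]addn0 iotaDl.
rewrite filter_map size_map -(size_map s); apply: length_values => //.
- exact: latticeA.
- by rewrite (map_inj_uniq s_inj) filter_uniq // iota_uniq.
rewrite -s_range; apply/seteqP; split=> [_ [[j _ <-] jM]|_ /mapP[j + ->]] /=.
  apply: map_f; rewrite mem_filter /= mem_iota add0n; apply/andP; split.
    exact/asboolP.
  rewrite ltnNge; apply/negP => nj; apply: jM.
  by apply: (values_sub FM); apply/values_filtration.
by rewrite mem_filter => /andP[/asboolP jM _]; split=> //; exists j.
Qed.

Lemma length_filtration n : length A A (F n) = n.
Proof.
rewrite (length_index_missing (n := n)) //; last exact: lattice_filtration.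
rewrite (_ : [seq _ <- _ | _] = index_iota 1 n.+1).
  by rewrite size_iota; lia.
apply/all_filterP/allP => h; rewrite mem_index_iota => hn.
by apply/asboolP; rewrite values_filtration; lia.
Qed.

(** The chain R = R : R_0, R : R_1, ..., R : R_n telescopes. *)
Lemma length_colon_filtration n :
  length A (colon A (F n)) A =
  (\sum_(1 <= h < n.+1) length A (colon A (F h)) (colon A (F h.-1)))%N.
Proof.
have lF i : lattice (colon A (F i)).
  by apply: lattice_colon; [exact: latticeA|exact: lattice_filtration].
have subF i : colon A (F i) `<=` colon A (F i.+1).
  move=> x xF y [Ay gy]; apply: xF; split=> //; apply: val_ge_sub gy.
  by rewrite leq_s.
elim: n => [|n IHn].
  by rewrite filtration0 colonAA big_geq // lengthMM //; apply: latticeA.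
rewrite big_nat_recr //= -IHn addnC; apply: lengthD => //; first exact: latticeA.
by move=> x Ax y [Ay _]; apply: AM.
Qed.

(** * Ideals and their biduals *)

Variable M : set K.
Hypotheses (lM : lattice M) (MA : M `<=` A).
Local Notation "J ^*" := (colon A J).
Local Notation r h := (length A (colon A (F h)) (colon A (F h.-1))).
Let V := [set h.+1 | h in [set h | values v (M^*^*) (s h)]].
Let gammaM := largest_submodule (ge 0) M.

Lemma sub_bidual : M `<=` M^*^*.
Proof. by move=> x Mx y /(_ x Mx); rewrite mulrC. Qed.

Lemma bidual_subA : M^*^* `<=` A.
Proof. by move=> x /(_ 1); rewrite mulr1; apply=> y /MA; rewrite mul1r. Qed.

Lemma lattice_dual J : lattice J -> lattice (J^*).
Proof. exact/lattice_colon/latticeA. Qed.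

Lemma length_A_bidual :
  length A A M = (length A A (M^*^*) + length A (M^*^*) M)%N.
Proof.
apply: lengthD => //; [exact: latticeA | |exact: sub_bidual|exact: bidual_subA].
by do 2!apply: lattice_dual.
Qed.

Lemma largest_submodule_filtration : exists n, gammaM = F n.
Proof.
have [c gE] := largest_submodule_val_ge lM; rewrite /gammaM gE.
have cA : ge c `<=` A by rewrite -gE => x [J [_ JM] Jx]; apply/MA/JM.
have [x vx] := exists_val vP c vt.
have [n _ sn] : range s c.
  by rewrite s_range; exists x => //; apply: cA; rewrite /val_ge /= vx.
by exists n; rewrite sn; apply/seteqP; split=> [y cy|y [] //]; split=> //; apply: cA.
Qed.

(** The last clause solves for l(I' / R), with I' = R : I, in
    l((R : R_n) / I') + l(I' / R) = r_1 + ... + r_n, where R_n is the largest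
    ideal of the valuation ring inside I: the terms with h in V^I are absorbed by
    the subtracted parenthesis, which is d(I). *)
Lemma missing_values : exists ws : seq nat,
  [/\ uniq ws, [set h | (1 <= h)%N /\ ~ V h] = [set` ws],
      length A A (M^*^*) = size ws &
      (length A (M^*) A)%:Z = \sum_(h <- ws) (r h)%:Z
        - ((length A (gammaM^*) (M^*))%:Z
           - \sum_(1 <= h < (length A A gammaM).+1 | h \in V) (r h)%:Z)].
Proof.
have [n gE] := largest_submodule_filtration.
have gM : F n `<=` M by rewrite -gE => x [J [_ JM] Jx]; apply: JM.
have lM' := lattice_dual lM; have lM'' := lattice_dual lM'.
have VP j : V j.+1 <-> values v (M^*^*) (s j).
  by split=> [[i iM [<-]] //|jM]; exists j.
have VPn h : (0 < h)%N -> `[< ~ values v (M^*^*) (s h.-1) >] = (h \notin V).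
  case: h => // j _; apply/asboolP/negP => [nj /set_mem /VP //|nV jM].
  exact/nV/mem_set/VP.
exists [seq h <- index_iota 1 n.+1 | h \notin V]; split.
- by rewrite filter_uniq // iota_uniq.
- apply/seteqP; split=> h /=; rewrite mem_filter mem_index_iota.
    move=> [h1 hV]; rewrite h1 ltnS; apply/andP; split.
      by apply/negP => /set_mem.
    case: h h1 hV => // j _ hV; rewrite ltnNge; apply/negP => nj.
    apply/hV/VP/(values_sub (subset_trans gM sub_bidual)).
    exact/values_filtration.
  by move=> /and3P[hV h1 _]; split=> // /mem_set; apply/negP.
- rewrite (length_index_missing (n := n)) //; first last.
  + exact: subset_trans sub_bidual.
  + exact: bidual_subA.
  congr size; apply: eq_in_filter => h; rewrite mem_index_iota => /andP[h1 _].
  exact: VPn.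
rewrite gE length_filtration big_filter.
have := length_colon_filtration n.
rewrite (lengthD (N := (F n)^*) (M := M^*) (L := A)) //; first last.
- by move=> x xM y /gM; apply: xM.
- by move=> x Ax y /MA; apply: AM.
- exact: latticeA.
- exact/lattice_dual/lattice_filtration.
move/(congr1 Posz); rewrite PoszD (big_morph Posz PoszD erefl).
rewrite [X in _ = X -> _](bigID (fun h => h \in V)) /=.
set inV := (\sum_(_ <= _ < _ | _ \in _) _).
set outV := (\sum_(_ <= _ < _ | _ \notin _) _).
set l1 := length _ _ _; set l2 := length _ _ _; lia.
Qed.

End Lattice.

(** * Common denominators *)

Section Fraction.
Local Set Implicit Arguments.
Local Unset Strict Implicit.
Variable R : idomainType.
Local Notation K := {fraction R}.
Local Notation RK := (range (@tofrac R)).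

Lemma frac_denom (x : K) : exists2 d : R, d != 0 & RK (tofrac d * x).
Proof.
elim/quotW: x => q; exists (\d_q); first exact: denom_ratioP.
exists (\n_q) => //.
unlock tofrac; rewrite -[RHS]FracField.pi_mul; apply/eqP.
rewrite FracField.equivf_def /FracField.mulf.
rewrite !numden_Ratio ?mulf_neq0 ?oner_neq0 ?denom_ratioP //.
by rewrite !mul1r mulrC.
Qed.

(** Applied to the integral closure, this makes the conductor nonzero. *)
Lemma span_denom (e : seq K) : exists2 d : R, d != 0 &
  forall x, Defs.span RK e x -> RK (tofrac d * x).
Proof.
have [d d0 dP] : exists2 d : R, d != 0 & forall x, x \in e -> RK (tofrac d * x).
  elim: e => [|x e [d d0 dP]]; first by exists 1; rewrite ?oner_neq0.
  have [d' d'0 [a _ aE]] := frac_denom x; exists (d * d'); first by rewrite mulf_neq0.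
  move=> y; rewrite inE => /orP[/eqP ->|/dP [b _ bE]].
    by exists (d * a); rewrite // !rmorphM /= -mulrA aE.
  by exists (d' * b); rewrite // rmorphM /= bE rmorphM mulrCA mulrA.
exists d => // _ [c cA ->]; rewrite mulr_sumr.
apply: big_ind => [|_ _ [a _ <-] [b _ <-]|i _].
- by exists 0; rewrite ?rmorph0.
- by exists (a + b); rewrite ?rmorphD.
have [a _ aE] := dP _ (mem_nth 0 (ltn_ord i)); have [b _ bE] := cA i.
by exists (b * a); rewrite // rmorphM /= aE bE mulrCA.
Qed.

End Fraction.

(** * The formulas for a(I) and b(I) *)

Theorem theorem3p10 (R : idomainType) (m : idealr R)
  (v : {fraction R} -> \bar int) (t : {fraction R}) (s : nat -> int)
  (noethR : noetherian R) (localR : local_ring m) (dimR : krull_dim R 1)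
  (infk : infinite_set [set: {ideal_quot m}])
  (finRbar : finitely_generated (range (@tofrac R)) (@integral_closure R))
  (dvrRbar : dvr (@integral_closure R) v t)
  (resR : residually_rational m t)
  (s_enum : value_enum v s)
  (I0 : idealr R) (I0_neq0 : exists2 x, x \in I0 & x != 0) :
  let I := ideal_in_frac I0 in
  let r := (cm_type m)%:Z in
  let r_ h := (type_seq v s h)%:Z in
  let l := (lenR (dual (dual I)) I)%:Z in
  let W := [set h | (1 <= h)%N /\ ~ V_ v s I h] in
  [/\ finite_set W,
      a_ I = \sum_(h \in W) (r_ h - 1) - l - d_ v s I
    & b_ m I = \sum_(h \in W) (r - r_ h) + r * l + d_ v s I].
Proof.
move=> I r r_ l W.
have [vP vt RbarE] := dvrRbar; have [s_homo s_range] := s_enum.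
set A := range (@tofrac R) in s_range *.
have A1 : A 1 by exists 1; rewrite ?rmorph1.
have AN1 : A (-1) by exists (-1); rewrite ?rmorphN1.
have AM a b : A a -> A b -> A (a * b).
  by move=> [x _ <-] [y _ <-]; exists (x * y); rewrite ?rmorphM.
have AD a b : A a -> A b -> A (a + b).
  by move=> [x _ <-] [y _ <-]; exists (x + y); rewrite ?rmorphD.
have ge0E : @integral_closure R = val_ge v 0 by [].
have A_ge0 : A `<=` val_ge v 0.
  by rewrite -ge0E => _ [a _ <-]; apply: integral_id.
have A_residue x : val_ge v 0 x -> exists2 a, A a & val_ge v 1 (x - a).
  rewrite -ge0E => xB; have [_ /(_ x xB) [a [y yB yE]]] := resR.
  exists (tofrac a); first by exists a.
  rewrite -yE -[1]addr0; apply: val_geM => //; first by rewrite /val_ge /= vt.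
  by rewrite -ge0E.
(* if d is a common denominator of the integral closure and v x >= v d, then
   x = d * (x / d) with x / d integral *)
have A_lattice : exists a, val_ge v a `<=` A.
  have [e eE] := finRbar; have [d d0 dP] := span_denom e.
  have d'0 : tofrac d != 0 by rewrite tofrac_eq0.
  have [h vd] := val_fin vP d'0; exists h => x gx.
  rewrite -(divfK d'0 x) mulrC; apply: dP; rewrite -eE ge0E -(subrr h).
  exact: val_ge_div.
have IA : I `<=` A by move=> _ [x _ <-]; exists x.
have lI : lattice A v I.
  split; last by exists 0; apply: subset_trans A_ge0.
    split; first by exists 0; rewrite ?rmorph0 //= rpred0.
      move=> _ _ [x xI <-] [y yI <-].
      by exists (x + y); rewrite ?rmorphD //= rpredD.
    move=> _ _ [a _ <-] [x xI <-].
    by exists (a * x); rewrite ?rmorphM //= idealMr.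
  (* I contains x * R for a nonzero x in I, hence x * ge a *)
  have [x xI x0] := I0_neq0; have [a aA] := A_lattice.
  have x'0 : tofrac x != 0 by rewrite tofrac_eq0.
  have [h vx] := val_fin vP x'0; exists (a + h) => y gy.
  have [b _ bE] : A (y / tofrac x).
    by apply: aA; rewrite -(addrK h a); apply: val_ge_div.
  by exists (b * x); [rewrite /= idealMr|rewrite rmorphM /= bE divfK].
have [ws [uws WE sws lenE]] := missing_values vP vt A1 AN1 AM AD A_ge0 A_residue
  A_lattice s_homo s_range lI IA.
have lenI := length_A_bidual vP vt A1 AN1 AM AD A_ge0 A_residue A_lattice lI IA.
have WE' : W = [set` ws] by exact: WE.
have lenE' : (lenR (dual I) A)%:Z = \sum_(h <- ws) r_ h - d_ v s I.
  by rewrite /d_ /n_ /gamma ge0E; exact: lenE.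
have lenI' : (lenR A I)%:Z = (size ws)%:Z + l.
  by rewrite /lenR lenI sws PoszD.
have sum_const x : \sum_(h <- ws) x = x * (size ws)%:Z.
  by rewrite big_const_seq count_predT iter_addr_0 -mulr_natr natz.
rewrite /a_ /b_ WE' -!fsbig_seq // !sumrB !sum_const lenE' lenI'.
split; [exact: finite_seq|ring|ring].
Qed.
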